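(* Let $n\ge 21$ be an integer. The minimum number $F$ of filled cells achievable in an MOPLS($n$) is \[F=\left\{\begin{array}{cl} n^2/3 & \text{if } n\equiv 0 \pmod 3,\\ (n^2+2)/3 & \text{if } n\equiv 1 \text{ or } 2 \pmod 3\end{array}\right\}=\left\lceil \frac{n^2}{3}\right\rceil .\] Moreover, in each of these cases, the minimum frequency $m$ of an MOPLS($n$) having this minimum number of filled cells is $m=\lfloor n/3\rfloor$.
   Context: A partial Latin square of order $n$, PLS($n$), is an $n\times n$ array, each of whose cells is either empty or filled with one element of a fixed $n$-element set of entries, such that each element of the entry set occurs at most once in every row and at most once in every column. Two partial Latin squares of the same order $n$ having the same filled cells as one another are orthogonal if, when superimposed, each of the $n^2$ possible ordered pairs (first entry, second entry) appears at most once in the cells of the superimposed square. An OPLS($n$) is the superimposed array of such a pair: an $n\times n$ array in which each cell is either empty or filled with an ordered pair (first entry, second entry), where first entries come from a fixed $n$-element set and second entries come from a fixed $n$-element set, such that each first entry symbol occurs at most once in each row and at most once in each column, likewise each second entry symbol, and each ordered pair of symbols occurs in at most one cell. An MOPLS($n$) is a maximal OPLS($n$), i.e. an OPLS($n$) that cannot be extended to another OPLS($n$) (with the same row, column, first entry and second entry sets) by inserting any entry pair into any empty cell. The frequency of a row (column) is the number of filled cells in that row (column). The frequency of a first entry symbol (second entry symbol) is the number of cells in which it appears as first (second) entry; symbols of the $n$-element entry sets that do not appear have frequency $0$. The minimum frequency of an MOPLS($n$) is the minimum of the frequencies of all rows, all columns, all first entry symbols and all second entry symbols. *)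

(* Defs.v *)
From mathcomp Require Import all_boot all_order all_algebra.

Set Implicit Arguments.
Unset Strict Implicit.
Unset Printing Implicit Defensive.

(* Rows, columns, first entries and second entries are all indexed by 'I_n;
   an empty cell is None. *)

Definition is_pls (n : nat) (L : 'M[option 'I_n]_n) : Prop :=
  (forall (i j j' : 'I_n) (s : 'I_n),
     L i j = Some s -> L i j' = Some s -> j = j') /\
  (forall (i i' j : 'I_n) (s : 'I_n),
     L i j = Some s -> L i' j = Some s -> i = i').

Definition first_entries (n : nat) (A : 'M[option ('I_n * 'I_n)]_n) :
  'M[option 'I_n]_n := map_mx (omap fst) A.

Definition second_entries (n : nat) (A : 'M[option ('I_n * 'I_n)]_n) :
  'M[option 'I_n]_n := map_mx (omap snd) A.

(* A is the superposition of its two projections, which automatically have the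
   same filled cells; the last clause is their orthogonality. *)
Definition is_opls (n : nat) (A : 'M[option ('I_n * 'I_n)]_n) : Prop :=
  [/\ is_pls (first_entries A),
      is_pls (second_entries A) &
      forall (i j i' j' : 'I_n) (e : 'I_n * 'I_n),
        A i j = Some e -> A i' j' = Some e -> i = i' /\ j = j'].

Definition insert_entry (n : nat) (A : 'M[option ('I_n * 'I_n)]_n)
    (i j : 'I_n) (e : 'I_n * 'I_n) : 'M[option ('I_n * 'I_n)]_n :=
  \matrix_(i', j') if (i' == i) && (j' == j) then Some e else A i' j'.

Definition is_mopls (n : nat) (A : 'M[option ('I_n * 'I_n)]_n) : Prop :=
  is_opls A /\
  forall (i j : 'I_n) (e : 'I_n * 'I_n),
    A i j = None -> ~ is_opls (insert_entry A i j e).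

Definition nb_filled (n : nat) (A : 'M[option ('I_n * 'I_n)]_n) : nat :=
  #|[set c : 'I_n * 'I_n | A c.1 c.2 != None]|.

Definition row_freq (n : nat) (A : 'M[option ('I_n * 'I_n)]_n) (i : 'I_n) : nat :=
  #|[set j : 'I_n | A i j != None]|.

Definition col_freq (n : nat) (A : 'M[option ('I_n * 'I_n)]_n) (j : 'I_n) : nat :=
  #|[set i : 'I_n | A i j != None]|.

Definition entry_freq (n : nat) (L : 'M[option 'I_n]_n) (s : 'I_n) : nat :=
  #|[set c : 'I_n * 'I_n | L c.1 c.2 == Some s]|.

Definition is_minimum (P : nat -> Prop) (m : nat) : Prop :=
  P m /\ forall k : nat, P k -> m <= k.

Definition is_frequency (n : nat) (A : 'M[option ('I_n * 'I_n)]_n) (k : nat) : Prop :=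
  [\/ exists i : 'I_n, row_freq A i = k,
      exists j : 'I_n, col_freq A j = k,
      exists s : 'I_n, entry_freq (first_entries A) s = k |
      exists t : 'I_n, entry_freq (second_entries A) t = k].

Definition is_min_frequency (n : nat) (A : 'M[option ('I_n * 'I_n)]_n) (m : nat) : Prop :=
  is_minimum (is_frequency A) m.

Definition is_min_filled_mopls (n F : nat) : Prop :=
  is_minimum
    (fun k => exists2 A : 'M[option ('I_n * 'I_n)]_n, is_mopls A & nb_filled A = k) F.

(* Main.v *)
Require Import Defs.
From mathcomp Require Import all_boot all_order all_algebra.
From mathcomp Require Import perm zify lra.

(** Read a filled cell as a word of length four (row, column, first entry,
    second entry).  An OPLS(n) is then a code in which two distinct words agree
    in at most one position, and such a code is maximal exactly when every word
    agrees with some codeword in at least two positions ([oplsP], [moplsP]).  In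
    this form rows, columns and the two kinds of symbols play the same part.

    Lower bound ([covering_code_lower_bound]).  Let a symbol v0 in position p0
    have the smallest frequency m of all.  Its m codewords use m symbols in each
    of the other positions.  Among the symbols not so used, let v1 in position p1
    have the smallest frequency f, and in the other two positions p2, p3 let A2,
    A3 be the unused symbols that occur in the codewords through v1, with
    a = |A2| >= |A3| and a <= f.  A word with v0, v1 and unused symbols outside
    A2, A3 can only be covered in the positions p2, p3.  This requires
    (n - m - a)^2 codewords whose symbol in position p2 is neither in A2 nor one
    of the m used ones, while the latter two sets of symbols account for at least
    a f >= a^2 and m m codewords.  Hence there are at least m^2 + a^2 + b^2
    codewords, where m + a + b = n.  Such a sum is at least n^2 / 3, and when it
    is the smallest possible integer its terms differ pairwise by at most one,
    which, with n m as a second lower bound, makes m = floor(n / 3).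

    Attaining the bound ([mopls_of_three_orthogonal_arrays]).  Cut n into three
    nearly equal parts k1, k2, k3 and put a pair of orthogonal Latin squares of
    order k_i on the i-th part of the rows, columns and symbols.  By the
    pigeonhole principle any word has two positions in the same part, where the
    Latin squares cover it.

    Since n >= 21, the k_i are at least 7, and it remains to know that pairs of
    orthogonal Latin squares exist for all these orders: the theorem of Bose,
    Shrikhande and Parker ([oa_ge7]).  The orders which are not 2 mod 4 are
    products of odd orders, 4 and 8.  For n = 2 mod 4 one writes n = 3 t + u with
    t prime to 6 and u <= t odd, and applies Wilson's construction
    ([oa_wilson]) to the lines of slope 0, 1, 2, 3 over Z/t; this leaves the
    orders 10 and 14, for which starter blocks are given, and 30 = 3 * 10. *)

Set Implicit Arguments.
Unset Strict Implicit.
Unset Printing Implicit Defensive.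

Import GRing.Theory.

(** * Codes of length four *)

Definition agree_twice (S : Type) (v w : 'I_4 -> S) : Prop :=
  exists p q, [/\ p != q, v p = w p & v q = w q].

Definition freq (n : nat) (I : finType) (D : {set I}) (x : I -> 'I_4 -> 'I_n)
  (p : 'I_4) (u : 'I_n) : nat := #|[set d in D | x d p == u]|.

Definition word (S : Type) (c e : S * S) (p : 'I_4) : S :=
  match val p with 0 => c.1 | 1 => c.2 | 2 => e.1 | _ => e.2 end.

(** Each clause in the definition of an OPLS is this statement for one of the six
    pairs of positions; the pair row, column holds for any array. *)
Lemma oplsP (n : nat) (A : 'M[option ('I_n * 'I_n)]_n) :
  is_opls A <-> forall c c' e e', A c.1 c.2 = Some e -> A c'.1 c'.2 = Some e' ->
    agree_twice (word c e) (word c' e') -> c = c'.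
Proof.
split=> [[[r1 c1] [r2 c2] orth] [i j] [i' j'] [s t] [s' t'] /= Ac Ac'|pack].
  move=> [p [q []]]; wlog pq : p q / p < q.
    move=> H neq ep eq; case: (ltngtP p q) => [|qp|/val_inj e]; first by move/H; exact.
      by apply: (H q p) => //; rewrite eq_sym.
    by rewrite e eqxx in neq.
  have F1 : first_entries A i j = Some s by rewrite mxE Ac.
  have F1' : first_entries A i' j' = Some s' by rewrite mxE Ac'.
  have F2 : second_entries A i j = Some t by rewrite mxE Ac.
  have F2' : second_entries A i' j' = Some t' by rewrite mxE Ac'.
  case: p q pq => [[|[|[|[|p]]]] lp] [[|[|[|[|q]]]] lq] // _ _; rewrite /word /= => e1 e2.
  - by rewrite e1 e2.
  - by subst i' s'; rewrite (r1 _ _ _ _ F1 F1').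
  - by subst i' t'; rewrite (r2 _ _ _ _ F2 F2').
  - by subst j' s'; rewrite (c1 _ _ _ _ F1 F1').
  - by subst j' t'; rewrite (c2 _ _ _ _ F2 F2').
  - by subst s' t'; have [-> ->] := orth _ _ _ _ _ Ac Ac'.
have o1 : 1 < 4 by []. have o2 : 2 < 4 by []. have o3 : 3 < 4 by [].
have cell i j i' j' e e' p q : p != q -> A i j = Some e -> A i' j' = Some e' ->
    word (i, j) e p = word (i', j') e' p -> word (i, j) e q = word (i', j') e' q ->
    i = i' /\ j = j'.
  move=> pq Ac Ac' ep eq.
  by have [-> ->] := pack (i, j) (i', j') e e' Ac Ac' (ex_intro _ p (ex_intro _ q (And3 pq ep eq))).
have getF i j s : first_entries A i j = Some s -> exists t, A i j = Some (s, t).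
  by rewrite mxE; case: (A i j) => [[s' t]|] //= [->]; exists t.
have getS i j t : second_entries A i j = Some t -> exists s, A i j = Some (s, t).
  by rewrite mxE; case: (A i j) => [[s t']|] //= [->]; exists s.
split; [split | split |].
- move=> i j j' s /getF[t Ac] /getF[t' Ac'].
  by case: (cell _ _ _ _ _ _ ord0 (Ordinal o2) isT Ac Ac').
- move=> i i' j s /getF[t Ac] /getF[t' Ac'].
  by case: (cell _ _ _ _ _ _ (Ordinal o1) (Ordinal o2) isT Ac Ac').
- move=> i j j' t /getS[s Ac] /getS[s' Ac'].
  by case: (cell _ _ _ _ _ _ ord0 (Ordinal o3) isT Ac Ac').
- move=> i i' j t /getS[s Ac] /getS[s' Ac'].
  by case: (cell _ _ _ _ _ _ (Ordinal o1) (Ordinal o3) isT Ac Ac').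
- move=> i j i' j' e Ac Ac'.
  by case: (cell _ _ _ _ _ _ (Ordinal o2) (Ordinal o3) isT Ac Ac').
Qed.

(** Inserting a word into an empty cell destroys the OPLS exactly when the word
    shares two positions with a filled cell; a word whose cell is filled is
    covered in its row and column positions. *)
Lemma moplsP (n : nat) (A : 'M[option ('I_n * 'I_n)]_n) :
  is_mopls A <-> is_opls A /\ forall v, exists c e, A c.1 c.2 = Some e /\ agree_twice (word c e) v.
Proof.
split=> [[oA maxA]|[oA cov]]; split=> //.
  move=> v.
  pose c0 := (v ord0, v (inord 1)); pose e0 := (v (inord 2), v ord_max).
  have vE p : word c0 e0 p = v p.
    by case: p => [[|[|[|[|p]]]] lp] //; congr (v _); apply: val_inj; rewrite /= ?inordK.
  case E : (A c0.1 c0.2) => [e|].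
    by exists c0, e; split=> //; exists ord0, (inord 1); split=> //; rewrite -?val_eqE -?vE /word /= ?inordK.
  pose hit c := if A c.1 c.2 is Some e then
    [exists p : 'I_4, exists q : 'I_4, [&& p != q, word c e p == v p & word c e q == v q]]
    else false.
  have hitP c : hit c -> exists c e, A c.1 c.2 = Some e /\ agree_twice (word c e) v.
    rewrite /hit; case Ac : (A c.1 c.2) => [e|] // /existsP[p /existsP[q /and3P[pq /eqP ? /eqP ?]]].
    by exists c, e; split=> //; exists p, q.
  have [/existsP[c /hitP]//|/existsPn nohit] := boolP [exists c, hit c].
  case: (maxA _ _ e0 E); apply/oplsP => c c' e e'.
  have miss c1 e1 : A c1.1 c1.2 = Some e1 -> ~ agree_twice (word c1 e1) v.
    move=> Ac1 [p [q [pq ep eq]]]; have /negP[] := nohit c1; rewrite /hit Ac1.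
    by apply/existsP; exists p; apply/existsP; exists q; rewrite pq ep eq !eqxx.
  rewrite !mxE -!xpair_eqE -!surjective_pairing.
  have [->|_] := eqVneq c c0; have [->|_] := eqVneq c' c0 => //.
  - move=> [<-] /miss noagree [p [q [pq ep eq]]]; case: noagree.
    by exists p, q; rewrite -!vE.
  - move=> /miss noagree [<-] [p [q [pq ep eq]]]; case: noagree.
    by exists p, q; rewrite -!vE.
  - by move/oplsP: oA; apply.
move=> i j e Aij oB; have [c [e' [Ac agr]]] := cov (word (i, j) e).
have ne : c != (i, j) by apply: contra_eqN Aij => /eqP cE; rewrite -[i]/((i, j).1) -[j]/((i, j).2) -cE Ac.
move/oplsP: oB => /(_ c (i, j) e' e); rewrite !mxE !eqxx /= -xpair_eqE -surjective_pairing (negbTE ne).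
by move=> /(_ Ac erefl agr) cE; rewrite cE eqxx in ne.
Qed.

(** The word of a filled cell; the default [c] only serves empty cells. *)
Definition cell_word (n : nat) (A : 'M[option ('I_n * 'I_n)]_n) (c : 'I_n * 'I_n) : 'I_4 -> 'I_n :=
  word c (odflt c (A c.1 c.2)).

Definition filled (n : nat) (A : 'M[option ('I_n * 'I_n)]_n) := [set c : 'I_n * 'I_n | A c.1 c.2 != None].

Lemma is_frequencyP (n : nat) (A : 'M[option ('I_n * 'I_n)]_n) (k : nat) :
  is_frequency A k <-> exists p u, freq (filled A) (cell_word A) p u = k.
Proof.
have o1 : 1 < 4 by []. have o2 : 2 < 4 by []. have o3 : 3 < 4 by [].
have f0 u : freq (filled A) (cell_word A) ord0 u = row_freq A u.
  rewrite /freq /row_freq -[RHS](card_imset _ (_ : injective (fun j => (u, j)))); last by move=> ? ? [].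
  apply: eq_card => -[i j]; rewrite !inE /=; apply/andP/imsetP => [[Aij /eqP <-]|[j']].
    by exists j; rewrite ?inE.
  by rewrite inE => Auj [-> ->].
have f1 u : freq (filled A) (cell_word A) (Ordinal o1) u = col_freq A u.
  rewrite /freq /col_freq -[RHS](card_imset _ (_ : injective (fun i => (i, u)))); last by move=> ? ? [].
  apply: eq_card => -[i j]; rewrite !inE /=; apply/andP/imsetP => [[Aij /eqP <-]|[i']].
    by exists i; rewrite ?inE.
  by rewrite inE => Auj [-> ->].
have f2 u : freq (filled A) (cell_word A) (Ordinal o2) u = entry_freq (first_entries A) u.
  rewrite /freq /entry_freq; apply: eq_card => -[i j]; rewrite !inE mxE /cell_word /word /=.
  by case: (A i j) => [[s t]|].
have f3 u : freq (filled A) (cell_word A) (Ordinal o3) u = entry_freq (second_entries A) u.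
  rewrite /freq /entry_freq; apply: eq_card => -[i j]; rewrite !inE mxE /cell_word /word /=.
  by case: (A i j) => [[s t]|].
split=> [[[u <-]|[u <-]|[u <-]|[u <-]]|[p [u <-]]].
- by exists ord0, u.
- by exists (Ordinal o1), u.
- by exists (Ordinal o2), u.
- by exists (Ordinal o3), u.
- case: p => [[|[|[|[|p]]]] lp] //.
  + by constructor 1; exists u; rewrite -f0; congr freq; apply: val_inj.
  + by constructor 2; exists u; rewrite -f1; congr freq; apply: val_inj.
  + by constructor 3; exists u; rewrite -f2; congr freq; apply: val_inj.
  + by constructor 4; exists u; rewrite -f3; congr freq; apply: val_inj.
Qed.

(** * The lower bound *)

(** Allows the last two positions to be treated alike, so that they may be
    exchanged in the lower bound. *)
Lemma other_coordinates (p0 p1 : 'I_4) : p0 != p1 ->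
  exists p2 p3, p2 != p3 /\ forall p, (p \notin [set p0; p1]) = (p == p2) || (p == p3).
Proof.
move=> neq; have /cards2P[p2 [p3 [p23 E]]] : #|~: [set p0; p1]| == 2.
  by rewrite -(eqn_add2l #|[set p0; p1]|) cardsC cards2 neq card_ord.
by exists p2, p3; split=> // p; rewrite -in_setC E !inE.
Qed.

Lemma leq_card_freq (n k : nat) (I : finType) (D : {set I}) (x : I -> 'I_4 -> 'I_n) p
    (B : {set 'I_n}) :
  (forall u, u \in B -> k <= freq D x p u) -> #|B| * k <= #|[set d in D | x d p \in B]|.
Proof.
move=> kB; rewrite -sum_nat_const -sum1_card.
rewrite (partition_big (fun d => x d p) (mem B)) /=; last by move=> d; rewrite inE => /andP[].
apply: leq_sum => u uB; apply: leq_trans (kB u uB) _.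
rewrite sum1dep_card subset_leq_card //; apply/subsetP => d.
by rewrite !inE => /andP[-> /eqP ->]; rewrite uB eqxx.
Qed.

(** The three squares count the codewords whose symbol in a suitable position
    [p2] is used by the codewords through [v0], respectively by those through the
    rarest remaining symbol [v1], or by neither. *)
Lemma covering_code_lower_bound (n : nat) (I : finType) (D : {set I}) (x : I -> 'I_4 -> 'I_n)
    (p0 : 'I_4) (v0 : 'I_n) :
    {in D &, forall d d', agree_twice (x d) (x d') -> d = d'} ->
    (forall v, exists2 d, d \in D & agree_twice (x d) v) ->
    (forall q u, freq D x p0 v0 <= freq D x q u) ->
  exists a b, freq D x p0 v0 + a + b = n /\
    freq D x p0 v0 ^ 2 + a ^ 2 + b ^ 2 <= #|D|.
Proof.
move=> pack cov mmin; set m := freq D x p0 v0 in mmin *.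
pose slice p u := [set d in D | x d p == u].
have im_slice p q u : p != q -> #|[set x d q | d in slice p u]| = freq D x p u.
  move=> pq; rewrite card_in_imset // => d d'; rewrite !inE => /andP[dD /eqP du] /andP[dD' /eqP du'].
  by move=> dd'; apply: pack => //; exists p, q; rewrite du du'.
pose V q := [set x d q | d in slice p0 v0].
have cV q : q != p0 -> #|V q| = m by move=> qp; rewrite im_slice // eq_sym.
have cU q : q != p0 -> m + #|~: V q| = n by move=> qp; rewrite -(cV q qp) cardsC card_ord.
have [q0 q0p] : exists q0, q0 != p0.
  by have [->|] := eqVneq p0 ord0; [exists ord_max | exists ord0; rewrite eq_sym].
(* If every symbol is used next to v0, all n symbols have frequency n. *)
have [nm|mn] := leqP n m.
  exists 0, 0; have mE : m = n by have := cU q0 q0p; lia.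
  split; first by rewrite mE !addn0.
  rewrite !addn0 -mulnn {1}mE -{1}(card_ord n) -cardsT.
  apply: leq_trans (leq_card_freq (p := p0) (D := D) (x := x) (fun u _ => mmin p0 u)) _.
  by rewrite subset_leq_card //; apply/subsetP => d; rewrite inE => /andP[].
have [u0 u0U] : exists u, u \in ~: V q0.
  by apply/set0Pn; rewrite -card_gt0; have := cU q0 q0p; lia.
pose unused := [pred z : 'I_4 * 'I_n | (z.1 != p0) && (z.2 \in ~: V z.1)].
have unused0 : unused (q0, u0) by rewrite /= q0p.
(* The rarest symbol v1 among those never met together with v0. *)
case: (@arg_minnP _ (q0, u0) unused (fun z => freq D x z.1 z.2) unused0).
move=> [p1 v1] /andP[/= p10 v1U] fmin; set f := freq D x p1 v1 in fmin.
pose A q := [set x d q | d in slice p1 v1] :&: ~: V q.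
(* Both blocks of size |~: V p - A p| must be at least b, hence the ordering. *)
have [p2 [p3 [p23 oth A32]]] : exists p2 p3, [/\ p2 != p3,
    forall p, (p \notin [set p0; p1]) = (p == p2) || (p == p3) & #|A p3| <= #|A p2|].
  rewrite eq_sym in p10; have [p2 [p3 [p23 oth]]] := other_coordinates p10.
  have [le|/ltnW le] := leqP #|A p3| #|A p2|; first by exists p2, p3.
  by exists p3, p2; split=> //; [rewrite eq_sym | move=> p; rewrite orbC].
have [p20 p21] : p2 != p0 /\ p2 != p1.
  by apply/andP; rewrite -negb_or -in_set2 oth eqxx.
have [p30 p31] : p3 != p0 /\ p3 != p1.
  by apply/andP; rewrite -negb_or -in_set2 oth eqxx orbT.
have AU q : A q \subset ~: V q by apply: subsetIr.
have Af : #|A p2| <= f.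
  by rewrite /f -(im_slice p1 p2) ?subset_leq_card ?subsetIl // eq_sym.
have ca := cU p2 p20; have aU := subset_leq_card (AU p2).
exists #|A p2|, (#|~: V p2| - #|A p2|); split; first by rewrite -addnA subnKC.
pose inB (B : {set 'I_n}) := [set d in D | x d p2 \in B].
have split3 : #|inB (V p2)| + #|inB (A p2)| + #|inB (~: V p2 :\: A p2)| <= #|D|.
  have d1 : [disjoint inB (V p2) & inB (A p2)].
    by apply/pred0P => d /=; rewrite !inE; case: (_ \in V p2); rewrite ?andbF.
  have d2 : [disjoint inB (V p2) :|: inB (A p2) & inB (~: V p2 :\: A p2)].
    apply/pred0P => d /=; rewrite !inE; case: (d \in D) => //=.
    by case: (_ \in V p2); rewrite ?andbF //= !andbT; case: (_ \in _).
  have <- : #|inB (V p2) :|: inB (A p2)| = #|inB (V p2)| + #|inB (A p2)|.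
    by apply/eqP; rewrite (leq_card_setU _ _).2 ?d1 ?d2.
  have <- : #|(inB (V p2) :|: inB (A p2)) :|: inB (~: V p2 :\: A p2)| =
      #|inB (V p2) :|: inB (A p2)| + #|inB (~: V p2 :\: A p2)|.
    by apply/eqP; rewrite (leq_card_setU _ _).2 ?d1 ?d2.
  by rewrite subset_leq_card //; apply/subsetP => d; rewrite !inE; case: (d \in D).
apply: leq_trans split3; rewrite -!mulnn; apply: leq_add; first apply: leq_add.
- by rewrite -{1}(cV p2 p20) leq_card_freq.
- apply: leq_trans (leq_mul (leqnn _) Af) _; apply: leq_card_freq => u /(subsetP (AU p2)) uU.
  by apply: (fmin (p2, u)); rewrite /= p20.
(* Each pair (s, t) outside A p2 and A p3 forces a codeword of its own. *)
rewrite -(cardsDS (AU p2)).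
apply: leq_trans (_ : #|~: V p2 :\: A p2| * #|~: V p3 :\: A p3| <= _).
  have cUU : #|~: V p2| = #|~: V p3| by apply: (@addnI m); rewrite !cU.
  by rewrite leq_mul // !cardsDS // -cUU leq_sub.
rewrite -cardsX; apply: leq_trans (leq_imset_card (fun d => (x d p2, x d p3)) _).
apply/subset_leq_card/subsetP => -[s t] /setXP[/= sA tA].
pose v p := if p == p0 then v0 else if p == p1 then v1 else if p == p2 then s else t.
have vU p : p != p0 -> v p \notin V p.
  rewrite /v => /negbTE p0E; rewrite p0E.
  case: (eqVneq p p1) => [->|pp1]; first by rewrite in_setC in v1U.
  have : (p == p2) || (p == p3) by rewrite -oth !inE p0E (negbTE pp1).
  case: (eqVneq p p2) => [->|_ /eqP ->].
    by move: sA; rewrite !inE => /andP[_ ->].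
  by move: tA; rewrite !inE => /andP[_ ->].
have vA p : p != p0 -> p != p1 -> v p \notin [set x d p | d in slice p1 v1].
  move=> pp0 pp1; suff : v p \notin A p.
    by rewrite inE in_setC (vU p pp0) andbT.
  have : (p == p2) || (p == p3) by rewrite -oth !inE (negbTE pp0) (negbTE pp1).
  rewrite /v (negbTE pp0) (negbTE pp1); case: (eqVneq p p2) => [->|_ /eqP ->].
    by move: sA => /setDP[].
  by move: tA => /setDP[].
have [d dD [p [q [pq xp xq]]]] := cov v.
(* Neither v0 nor v1 can be one of the two agreements: the other symbol would
   then have been met together with it. *)
have no0 p' q' : p' != q' -> x d p' = v p' -> x d q' = v q' -> p' != p0.
  move=> neq xp' xq'; apply/eqP => p'0; subst p'.
  have q'0 : q' != p0 by rewrite eq_sym.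
  have /negP[] := vU q' q'0; rewrite -xq'; apply: imset_f.
  by rewrite inE dD xp' /v eqxx /=.
have p'0 := no0 p q pq xp xq; have q'0 := no0 q p (contra_neq esym pq) xq xp.
have no1 p' q' : p' != q' -> x d p' = v p' -> x d q' = v q' -> q' != p0 -> p' != p1.
  move=> neq xp' xq' q0'; apply/eqP => p'1; subst p'.
  have q1' : q' != p1 by rewrite eq_sym.
  have /negP[] := vA q' q0' q1'; rewrite -xq'; apply: imset_f.
  by rewrite inE dD xp' /v (negbTE p10) eqxx /=.
have p'1 := no1 p q pq xp xq q'0; have q'1 := no1 q p (contra_neq esym pq) xq xp p'0.
have v2 : v p2 = s by rewrite /v (negbTE p20) (negbTE p21) eqxx.
have v3 : v p3 = t by rewrite /v (negbTE p30) (negbTE p31) eq_sym (negbTE p23).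
have [xs xt] : x d p2 = s /\ x d p3 = t.
  have : (p == p2) || (p == p3) by rewrite -oth !inE (negbTE p'0) (negbTE p'1).
  have : (q == p2) || (q == p3) by rewrite -oth !inE (negbTE q'0) (negbTE q'1).
  rewrite -v2 -v3 => /orP[] /eqP q2 /orP[] /eqP p2'; subst p q => //.
  - by rewrite eqxx in pq.
  - by rewrite eqxx in pq.
apply/imsetP; exists d; last by rewrite xs xt.
by rewrite !inE dD xs /=; move: sA; rewrite !inE.
Qed.

Lemma mopls_bound (n : nat) (A : 'M[option ('I_n * 'I_n)]_n) : 0 < n -> is_mopls A ->
  exists m a b, [/\ is_min_frequency A m, m + a + b = n, m ^ 2 + a ^ 2 + b ^ 2 <= nb_filled A &
    n * m <= nb_filled A].
Proof.
move=> n0 /moplsP[/oplsP pack cov].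
pose F (z : 'I_4 * 'I_n) := freq (filled A) (cell_word A) z.1 z.2.
case: (@arg_minnP _ (ord0, Ordinal n0) xpredT F isT) => -[p u] _ pmin.
have minP q w : F (p, u) <= freq (filled A) (cell_word A) q w by apply: (pmin (q, w)).
have wordE c e : A c.1 c.2 = Some e -> cell_word A c = word c e by rewrite /cell_word => ->.
have [|v|a [b [sum sq]]] := @covering_code_lower_bound n _ (filled A) (cell_word A) p u _ _ minP.
- move=> c c'; rewrite !inE.
  case Ac : (A c.1 c.2) => [e|] // _; case Ac' : (A c'.1 c'.2) => [e'|] // _.
  by rewrite (wordE _ _ Ac) (wordE _ _ Ac'); apply: pack.
- have [c [e [Ac agr]]] := cov v; exists c; first by rewrite inE Ac.
  by rewrite (wordE _ _ Ac).
exists (F (p, u)), a, b; split=> //.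
  split; first by apply/is_frequencyP; exists p, u.
  by move=> k /is_frequencyP[q [w <-]].
rewrite -{1}(card_ord n) -cardsT.
apply: leq_trans (leq_card_freq (p := p) (fun w _ => minP p w)) _.
by rewrite subset_leq_card //; apply/subsetP => c; rewrite inE => /andP[].
Qed.

Lemma sum_sq_bound (n m a b : nat) : m + a + b = n -> (n ^ 2 + 2) %/ 3 <= m ^ 2 + a ^ 2 + b ^ 2.
Proof.
move=> <-; have : (m + a + b) ^ 2 <= 3 * (m ^ 2 + a ^ 2 + b ^ 2).
  have h1 := (nat_Cauchy m a).1; have h2 := (nat_Cauchy m b).1; have h3 := (nat_Cauchy a b).1.
  rewrite !sqrnD mulnDl; lia.
lia.
Qed.

(** The claim follows from
    6 (x^2 + y^2 + z^2) - 2 (x + y + z)^2 = 3 (y - x)^2 + (2 z - x - y)^2. *)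
Lemma sum_sq_close (x y z : nat) :
  3 * (x ^ 2 + y ^ 2 + z ^ 2) <= (x + y + z) ^ 2 + 2 -> y <= x + 1.
Proof.
move=> le; rewrite leqNgt; apply/negP => lt.
have [k yE] : exists k, y = x + 2 + k by exists (y - (x + 2)); lia.
have := (nat_Cauchy (2 * z) (x + y)).1; move: le; rewrite {}yE -!mulnn.
have := leq0n (k * k).
lia.
Qed.
(** The sum of squares only makes the three terms balanced; that [m] is the
    smallest possible one comes from counting by rows, [n * m]. *)
Lemma min_freq_of_sum_sq (n m a b : nat) : 2 < n -> m + a + b = n ->
  m ^ 2 + a ^ 2 + b ^ 2 <= (n ^ 2 + 2) %/ 3 -> n * m <= (n ^ 2 + 2) %/ 3 -> m = n %/ 3.
Proof.
move=> n2 sum sq nm.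
have sq3 : 3 * (m ^ 2 + a ^ 2 + b ^ 2) <= (m + a + b) ^ 2 + 2 by rewrite sum; lia.
(* The aim is 3 m <= n <= 3 m + 2. *)
have am : a <= m + 1 := sum_sq_close sq3.
have bm : b <= m + 1 by apply: (@sum_sq_close m b a); rewrite addnAC (addnAC m).
have m3 : 3 * m <= n.
  have nm3 : 3 * (n * m) <= n * n + 2 by rewrite -[n * n]/(n ^ 2); lia.
  rewrite leqNgt; apply/negP => lt.
  by have : n * n.+1 <= n * (3 * m) by [rewrite leq_mul2l lt orbT]; lia.
lia.
Qed.

(** * Pairs of orthogonal Latin squares *)

Definition pair_cover (I S : Type) (w : I -> 'I_4 -> S) : Prop :=
  forall (i j : 'I_4) (a b : S), i != j -> exists x, w x i = a /\ w x j = b.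

(** An OA(4, n), equivalently a pair of orthogonal Latin squares of order n.
    Asking for at most n^2 words that cover all pairs is the same as asking that
    every pair be covered exactly once (see [pair_cover_packing]), and it is what
    constructions establish most easily. *)
Definition orthogonal_array (n : nat) : Prop :=
  exists (I : finType) (w : I -> 'I_4 -> 'I_n), #|I| <= n ^ 2 /\ pair_cover w.

Lemma oa_of_cover (S I : finType) (w : I -> 'I_4 -> S) :
  #|I| <= #|S| ^ 2 -> pair_cover w -> orthogonal_array #|S|.
Proof.
move=> cI cov; exists I, (fun x i => enum_rank (w x i)); split=> // i j a b neq.
have [x [xi xj]] := cov i j (enum_val a) (enum_val b) neq.
by exists x; rewrite xi xj !enum_valK.
Qed.

Lemma cover_of_oa (S : finType) : orthogonal_array #|S| ->
  exists (I : finType) (w : I -> 'I_4 -> S), #|I| <= #|S| ^ 2 /\ pair_cover w.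
Proof.
move=> [I [w [cI cov]]]; exists I, (fun x i => enum_val (w x i)); split=> // i j a b neq.
have [x [xi xj]] := cov i j (enum_rank a) (enum_rank b) neq.
by exists x; rewrite xi xj !enum_rankK.
Qed.

Lemma oa1 : orthogonal_array 1.
Proof.
by exists unit, (fun _ _ => ord0); split=> [|i j a b _]; [rewrite card_unit | exists tt; rewrite !ord1].
Qed.

Lemma oa_mul (m n : nat) :
  orthogonal_array m -> orthogonal_array n -> orthogonal_array (m * n).
Proof.
move=> [I [v [cI vcov]]] [J [w [cJ wcov]]].
have -> : (m * n = #|{: 'I_m * 'I_n}|)%N by rewrite card_prod !card_ord.
apply: (@oa_of_cover _ (I * J)%type (fun x i => (v x.1 i, w x.2 i))).
  by rewrite !card_prod !card_ord expnMn leq_mul.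
move=> i j [a b] [a' b'] neq.
have [x [<- <-]] := vcov i j a a' neq; have [y [<- <-]] := wcov i j b b' neq.
by exists (x, y).
Qed.

Definition shift (G : zmodType) (U : Type) (g : G) (e : G + U) : G + U :=
  match e with inl x => inl (x + g)%R | inr u => inr u end.

(** Difference method: the starters are developed under the group [G], which
    fixes the infinite points [U].  Translation reduces covering a pair of finite
    points to realising their difference, and covering a mixed pair to realising
    its infinite point; pairs of infinite points are left to the array on [U]. *)
Lemma oa_develop (G : finZmodType) (U K : finType) (s : K -> 'I_4 -> G + U) :
    (#|K| <= #|G| + 2 * #|U|)%N ->
    (forall i j (d : G), i != j ->
       exists k x y, [/\ s k i = inl x, s k j = inl y & y = d + x]%R) ->
    (forall i j u, i != j -> exists k x, s k i = inr u /\ s k j = inl x) ->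
    orthogonal_array #|U| ->
  orthogonal_array (#|G| + #|U|).
Proof.
move=> cK cov_diff cov_inf /cover_of_oa [J [w [cJ wcov]]].
rewrite -card_sum.
pose v (z : (K * G) + J) i : G + U :=
  match z with inl (k, g) => shift g (s k i) | inr y => inr (w y i) end.
apply: (@oa_of_cover _ ((K * G) + J)%type v).
  rewrite !card_sum card_prod.
  apply: leq_trans (leq_add (leq_mul cK (leqnn _)) cJ) _.
  by rewrite sqrnD -!mulnn; move: #|G| #|U| => p q; nia.
move=> i j [a|a] [b|b] neq.
- have [k [x [y [ki kj yE]]]] := cov_diff i j (b - a)%R neq.
  exists (inl (k, a - x)%R); rewrite /= ki kj yE /=; split; congr inl.
    by rewrite addrC subrK.
  by rewrite addrACA subrK subrr addr0.
- have [k [x [kj ki]]] := cov_inf j i b (introN eqP (fun e => negP neq (introT eqP (esym e)))).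
  by exists (inl (k, a - x)%R); rewrite /= ki kj /= addrC subrK.
- have [k [x [ki kj]]] := cov_inf i j a neq.
  by exists (inl (k, b - x)%R); rewrite /= ki kj /= addrC subrK.
- by have [y [<- <-]] := wcov i j a b neq; exists (inr y).
Qed.

(** The hypotheses of [oa_develop] for [G = Z/g] in a form decided by
    computation: a row of [t] is a starter, its entries below [g] are residues
    mod [g] and [g + e] is the infinite point number [e]. *)
Definition starters_cover (g u : nat) (t : seq (seq nat)) : bool :=
  all (fun i => all (fun j => (i == j) ||
     all (fun d => has (fun w => let x := nth 0 w i in let y := nth 0 w j in
        [&& x < g, y < g & y == (d + x) %% g]) t) (iota 0 g) &&
     all (fun e => has (fun w => (nth 0 w i == g + e) && (nth 0 w j < g)) t) (iota 0 u))
   (iota 0 4)) (iota 0 4).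

Lemma oa_of_starters (g u : nat) (t : seq (seq nat)) :
  size t = g.+1 + 2 * u.+1 -> starters_cover g.+1 u.+1 t ->
  orthogonal_array u.+1 -> orthogonal_array (g.+1 + u.+1).
Proof.
move=> sz chk; rewrite -[u.+1]card_ord -[g.+1]card_ord.
pose dec (e : nat) : 'I_g.+1 + 'I_u.+1 :=
  if e < g.+1 then inl (inZp e) else inr (inZp (e - g.+1)).
pose s (k : 'I_(size t)) (i : 'I_4) := dec (nth 0 (nth [::] t k) i).
have row w : w \in t -> exists k, forall i, s k i = dec (nth 0 w i).
  by rewrite -index_mem => wt; exists (Ordinal wt) => i; rewrite /s nth_index -?index_mem.
have check (i j : 'I_4) : i != j ->
   (forall d, d < g.+1 -> exists2 w, w \in t &
      [/\ nth 0 w i < g.+1, nth 0 w j < g.+1 & nth 0 w j = (d + nth 0 w i) %% g.+1]) /\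
   (forall e, e < u.+1 -> exists2 w, w \in t &
      nth 0 w i = g.+1 + e /\ nth 0 w j < g.+1).
  move=> neq.
  have in4 (k : 'I_4) : (k : nat) \in iota 0 4 by rewrite mem_iota /=.
  have /allP/(_ _ (in4 i))/allP/(_ _ (in4 j)) := chk.
  rewrite val_eqE (negbTE neq) => /andP[/allP cd /allP ce]; split=> [d dg|e eu].
    have := cd d; rewrite mem_iota => /(_ dg)/hasP[w wt /and3P[? ? /eqP ?]].
    by exists w.
  have := ce e; rewrite mem_iota => /(_ eu)/hasP[w wt /andP[/eqP ? ?]].
  by exists w.
apply: (@oa_develop _ _ _ s); first by rewrite !card_ord sz.
- move=> i j d neq; have [w wt [xg yg yE]] := (check i j neq).1 d (ltn_ord d).
  have [k kE] := row w wt.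
  exists k, (inZp (nth 0 w i)), (inZp (nth 0 w j)); rewrite !kE /dec xg yg; split=> //.
  by apply: val_inj; rewrite /= yE modn_mod modnDmr.
- move=> i j e neq; have [w wt [xE yg]] := (check i j neq).2 e (ltn_ord e).
  have [k kE] := row w wt.
  by exists k, (inZp (nth 0 w j)); rewrite !kE /dec yg xE ltnNge leq_addr /= addKn valZpK.
Qed.

Definition rotations (w : seq nat) := [seq rot k w | k <- iota 0 4].

(** The words (x, y, x + y, x + w y) over the field of four elements, w being a
    generator of its units.  Nonzero elements are written as logarithms to base w
    and 0 as the infinite point 3, so that translation by 1 is multiplication by
    w and the starters stand for the points (x : y) of the projective line. *)
Lemma oa4 : orthogonal_array 4.
Proof.
by apply: (@oa_of_starters 2 0 [:: [:: 0; 3; 0; 0]; [:: 3; 0; 0; 1]; [:: 0; 0; 3; 2];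
  [:: 0; 1; 2; 1]; [:: 0; 2; 1; 3]]); last exact: oa1.
Qed.

(** As for order four, over the field of eight elements with w^3 = w + 1; the
    infinite point 7 is 0. *)
Lemma oa8 : orthogonal_array 8.
Proof.
by apply: (@oa_of_starters 6 0 [:: [:: 7; 0; 0; 1]; [:: 0; 7; 0; 0]; [:: 0; 0; 7; 3];
  [:: 0; 1; 3; 6]; [:: 0; 3; 1; 5]; [:: 0; 2; 6; 1]; [:: 0; 6; 2; 7]; [:: 0; 4; 5; 4];
  [:: 0; 5; 4; 2]]); last exact: oa1.
Qed.

Lemma unit_diff (T : comUnitRingType) (k i j : nat) :
    (forall c, 0 < c < k -> (c%:R : T)%R \is a GRing.unit) ->
  i < k -> j < k -> i != j -> (j%:R - i%:R : T)%R \is a GRing.unit.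
Proof.
move=> uk; wlog ij : i j / i < j => [H ik jk|ik jk _].
  rewrite neq_ltn => /orP[ij|ji]; first by rewrite H // ltn_eqF.
  by rewrite -unitrN opprB H // ltn_eqF.
by rewrite -natrB ?(ltnW ij) // uk // subn_gt0 ij /= (leq_ltn_trans (leq_subr _ _)).
Qed.

Lemma line_through_two_points (T : comUnitRingType) (k i j : nat) (a b : T) :
    (forall c, 0 < c < k -> (c%:R : T)%R \is a GRing.unit) ->
    i < k -> j < k -> i != j ->
  exists x h : T, (x + i%:R * h = a /\ x + j%:R * h = b)%R.
Proof.
move=> uk ik jk neq; have u := unit_diff uk ik jk neq.
set h := ((b - a) / (j%:R - i%:R))%R.
have hE : ((j%:R - i%:R) * h = b - a)%R by rewrite /h mulrC divrK.
exists (a - i%:R * h)%R, h; split; first by rewrite subrK.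
by rewrite -addrA [(- _ + _)%R]addrC -mulrBl hE addrC subrK.
Qed.

(** The word of (x, y) is (x, x + y, x + 2 y, y); each position is constant
    along one of four parallel classes of lines of the plane over [T], and 2 has
    to be a unit for lines of different classes to meet in one point. *)
Lemma oa_lines (T : finComUnitRingType) :
  (2%:R : T)%R \is a GRing.unit -> orthogonal_array #|T|.
Proof.
move=> u2.
pose w (z : T * T) (i : 'I_4) := if i < 3 then (z.1 + i%:R * z.2)%R else z.2.
apply: (@oa_of_cover _ _ w); first by rewrite card_prod.
have u3 c : 0 < c < 3 -> (c%:R : T)%R \is a GRing.unit.
  by case: c => [|[|[|c]]] //; rewrite unitr1.
move=> i j a b neq; rewrite /w.
have [i3|i3] := ltnP i 3; have [j3|j3] := ltnP j 3.
- have [x [h [? ?]]] := line_through_two_points a b u3 i3 j3 neq.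
  by exists (x, h).
- by exists (a - i%:R * b, b)%R; rewrite /= subrK.
- by exists (b - j%:R * a, a)%R; rewrite /= subrK.
- by have := ltn_ord i; have := ltn_ord j; move: neq; rewrite -val_eqE /=; lia.
Qed.

Lemma card_Zn (n : nat) : 1 < n -> #|'Z_n| = n.
Proof. by move=> n1; rewrite card_ord Zp_cast. Qed.

Lemma oa_odd (n : nat) : odd n -> orthogonal_array n.
Proof.
case: (ltngtP n 1) => [|n1 on|-> _]; [by case: n | | exact: oa1].
rewrite -(card_Zn n1); apply: oa_lines.
by rewrite unitZpE // coprimen2.
Qed.

(** After renaming the symbols in each position, any chosen block becomes
    (None, None, None, None); removing it leaves an array with a hole of size
    one, where [None] marks the hole. *)
Lemma oa_punctured (m : nat) : orthogonal_array m.+1 ->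
  exists (I : finType) (w : I -> 'I_4 -> option 'I_m), #|I| <= m ^ 2 + 2 * m /\
    forall i j a b, i != j -> (a, b) != (None, None) -> exists x, w x i = a /\ w x j = b.
Proof.
have -> : m.+1 = #|{: option 'I_m}| by rewrite card_option card_ord.
move=> /cover_of_oa[I [w [cI cov]]].
have [z _] := cov ord0 ord_max None None isT.
pose v (x : {x | x != z}) i := tperm None (w z i) (w (val x) i).
exists {x | x != z}, v; split.
  rewrite card_sig -(leq_add2l 1) -[in leqLHS](card1 z) cardC.
  by rewrite (leq_trans cI) // card_option card_ord -addn1 sqrnD; lia.
move=> i j a b neq ab.
have [x [xi xj]] := cov i j (tperm None (w z i) a) (tperm None (w z j) b) neq.
suff xz : x != z by exists (Sub x xz); rewrite /v /= xi xj !tpermK.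
apply: contra ab => /eqP xz; rewrite {}xz in xi xj.
rewrite xpair_eqE -(inj_eq (@perm_inj _ (tperm None (w z i)))) -xi tpermL eqxx.
by rewrite -(inj_eq (@perm_inj _ (tperm None (w z j)))) -xj tpermL eqxx.
Qed.

(** Wilson's construction.  The points of [T * 'I_4] and the slopes in [T] form a
    transversal design with five groups, whose blocks are the lines
    i |-> x + i h together with h; this needs 1, 2, 3 to be units.  Each point is
    given weight [m] and [u] of the slopes are kept as new points.  A line of
    kept slope h carries an array of order [m + 1] punctured at the block of the
    new points h, any other line one of order [m], and the new points an array of
    order [u]. *)
Lemma oa_wilson (T : finComUnitRingType) (m a u : nat) :
    #|T| = u + a ->
    (2%:R : T)%R \is a GRing.unit -> (3%:R : T)%R \is a GRing.unit ->
    orthogonal_array m -> orthogonal_array m.+1 -> orthogonal_array u ->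
  orthogonal_array (m * #|T| + u).
Proof.
move=> cT u2 u3 [I [v [cI vcov]]] /oa_punctured[J [w [cJ wcov]]] [K [y [cK ycov]]].
have u4 c : 0 < c < 4 -> (c%:R : T)%R \is a GRing.unit.
  by case: c => [|[|[|[|c]]]] //; rewrite unitr1.
(* The slopes: the u kept ones and the a others. *)
pose hole (h : 'I_u + 'I_a) : T := enum_val (cast_ord (esym cT) (unsplit h)).
have holeP (h : T) : exists h', h = hole h'.
  exists (split (cast_ord cT (enum_rank h))).
  by rewrite /hole splitK cast_ordK enum_rankK.
pose pt (x : T) (h : 'I_u) (c : option 'I_m) : T * 'I_m + 'I_u :=
  if c is Some c' then inl (x, c') else inr h.
pose f (z : T * ('I_a * I + 'I_u * J) + K) (i : 'I_4) : T * 'I_m + 'I_u :=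
  match z with
  | inl (x, inl (h, e)) => inl (x + i%:R * hole (inr h), v e i)%R
  | inl (x, inr (h, e)) => pt (x + i%:R * hole (inl h))%R h (w e i)
  | inr e => inr (y e i)
  end.
have -> : m * #|T| + u = #|{: T * 'I_m + 'I_u}|.
  by rewrite card_sum card_prod !card_ord mulnC.
apply: (@oa_of_cover _ _ f).
  rewrite !card_sum !card_prod card_sum !card_prod !card_ord cT.
  apply: leq_trans (_ : (u + a) * (a * m ^ 2 + u * (m ^ 2 + 2 * m)) + u ^ 2 <= _).
    by rewrite leq_add ?leq_mul ?leq_add ?leq_mul.
  by rewrite -!mulnn; nia.
move=> i j p q neq.
(* A weighted point and a new point: the new point fixes the slope of the line. *)
have mixed (k l : 'I_4) (x : T) (c : 'I_m) (h : 'I_u) : k != l ->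
    exists z, f z k = inl (x, c) /\ f z l = inr h.
  move=> kl; have [e [ek el]] := wcov k l (Some c) None kl isT.
  exists (inl (x - k%:R * hole (inl h), inr (h, e)))%R.
  by rewrite /= ek el /= subrK.
case: p q => [[x c]|h] [[x' c']|h'].
- have [x0 [s [si sj]]] := line_through_two_points x x' u4 (ltn_ord i) (ltn_ord j) neq.
  have [[h|h] hE] := holeP s; rewrite {}hE in si sj.
    have [e [ei ej]] := wcov i j (Some c) (Some c') neq isT.
    by exists (inl (x0, inr (h, e))); rewrite /= ei ej /= si sj.
  have [e [ei ej]] := vcov i j c c' neq.
  by exists (inl (x0, inl (h, e))); rewrite /= ei ej si sj.
- exact: mixed.
- have [z [zj zi]] := mixed j i x' c' h (contra_neq esym neq).
  by exists z.
- have [e [ei ej]] := ycov i j h h' neq.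
  by exists (inr e); rewrite /= ei ej.
Qed.

(** The weight is 3 because orthogonal Latin squares exist for the consecutive
    orders 3 and 4. *)
Lemma oa_3t_plus_u (t u : nat) : 1 < t -> coprime t 6 -> u <= t -> orthogonal_array u ->
  orthogonal_array (3 * t + u).
Proof.
move=> t1 /[!(coprimeMr t 2 3)] /andP[t2 t3] ut ou.
rewrite -[in 3 * t](card_Zn t1); apply: (@oa_wilson _ _ (t - u)) => //.
- by rewrite card_Zn // subnKC.
- by rewrite unitZpE.
- by rewrite unitZpE.
- exact: oa_odd.
- exact: oa4.
Qed.

(** Seven residues and three infinite points.  The four rotations of a starter
    (oo, 0, x, y) give all four positions the same part; only the differences of
    cyclically adjacent entries, x and y - x, which must run through the nonzero
    residues, and of opposite ones, y up to sign, have to be right. *)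
Lemma oa10 : orthogonal_array 10.
Proof.
apply: (@oa_of_starters 6 2 ([:: 0; 0; 0; 0] ::
  flatten [seq rotations w | w <- [:: [:: 7; 0; 1; 4]; [:: 8; 0; 2; 1]; [:: 9; 0; 4; 2]]])) => //.
exact: oa_odd.
Qed.

(** The same method with eleven residues; one finite starter is rotated too, as
    three infinite points do not produce enough differences. *)
Lemma oa14 : orthogonal_array 14.
Proof.
apply: (@oa_of_starters 10 2 ([:: 0; 0; 0; 0] ::
  flatten [seq rotations w | w <- [:: [:: 0; 1; 4; 6]; [:: 11; 0; 4; 1]; [:: 12; 0; 6; 2]; [:: 13; 0; 9; 8]]])) => //.
exact: oa_odd.
Qed.

(** Factors 4 are split off; the last step needs the factor 8 instead when the
    cofactor would be twice an odd number. *)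
Lemma oa_not_2_mod_4 (n : nat) : 0 < n -> n %% 4 != 2 -> orthogonal_array n.
Proof.
elim/ltn_ind: n => n IH n0 n2.
have [/oa_odd//|even_n] := boolP (odd n).
have [k nE] : exists k, n = 4 * k by exists (n %/ 4); lia.
have [k2|k2] := eqVneq (k %% 4) 2.
  have -> : n = 8 * (k %/ 2) by lia.
  by apply: oa_mul oa8 _; apply: oa_odd; lia.
by rewrite nE; apply: oa_mul oa4 _; apply: IH => //; lia.
Qed.

(** For n = 2 mod 4, any t prime to 6 with n / 4 <= t <= n / 3 gives an odd u.
    The largest integer up to n / 3 that is prime to 6 is at most 3 less than
    floor(n / 3), which suffices from n = 42 on. *)
Lemma oa_ge7 (n : nat) : 7 <= n -> orthogonal_array n.
Proof.
move=> n7; have [n2|] := eqVneq (n %% 4) 2; last by apply: oa_not_2_mod_4; lia.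
have [->|n10] := eqVneq n 10; first exact: oa10.
have [->|n14] := eqVneq n 14; first exact: oa14.
have [->|n30] := eqVneq n 30; first by apply: (@oa_mul 3 10) oa10; exact: oa_odd.
have [t [t1 t6 tn nt]] : exists t, [/\ 1 < t, coprime t 6, 3 * t <= n & n <= 4 * t].
  have cop s : s %% 6 = 1 \/ s %% 6 = 5 -> coprime s 6.
    by rewrite /coprime -gcdn_modl => -[->|->].
  have [q42|q42] := leqP 42 n.
    have [r [rE r3]] : exists r, ((n %/ 3 - r) %% 6 = 1 \/ (n %/ 3 - r) %% 6 = 5) /\ r <= 3.
      have : n %/ 3 %% 6 < 6 by lia.
      case E : (n %/ 3 %% 6) => [|[|[|[|[|[|//]]]]]] _; 
      by [exists 0; lia | exists 1; lia | exists 2; lia | exists 3; lia].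
    by exists (n %/ 3 - r); split; try lia; exact: cop.
  have [->|n18] := eqVneq n 18; first by exists 5.
  have [->|n22] := eqVneq n 22; first by exists 7.
  have [->|n26] := eqVneq n 26; first by exists 7.
  have [->|n34] := eqVneq n 34; first by exists 11.
  have [->|n38] := eqVneq n 38; first by exists 11.
  lia.
have odd_t : odd t by move: t6; rewrite (coprimeMr t 2 3) coprimen2 => /andP[].
rewrite -(subnKC tn); apply: oa_3t_plus_u => //; first by lia.
by apply: oa_odd; lia.
Qed.

(** * The extremal squares *)

(** For two fixed positions, a map from at most |S|^2 words onto the pairs of
    symbols is injective. *)
Lemma pair_cover_packing (S I : finType) (w : I -> 'I_4 -> S) :
  #|I| <= #|S| ^ 2 -> pair_cover w ->
  forall y y', agree_twice (w y) (w y') -> y = y'.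
Proof.
move=> cI cov y y' [p [q [pq ep eq]]].
pose f y := (w y p, w y q).
have fS : #|[set f y | y in [set: I]]| = #|S| ^ 2.
  rewrite -mulnn -card_prod -cardsT; congr (#|pred_of_set _|).
  apply/setP => -[a b]; rewrite !inE; apply/imsetP.
  by have [z [za zb]] := cov p q a b pq; exists z; rewrite /f ?za ?zb.
have /imset_injP : #|[set f y | y in [set: I]]| == #|[set: I]|.
  by rewrite eqn_leq leq_imset_card fS cardsT.
by apply; rewrite ?inE // /f ep eq.
Qed.

(** The symbols form an arbitrary finite type so that a square can be described
    on a disjoint union. *)
Lemma mopls_of_code (S I : finType) (w : I -> 'I_4 -> S) :
    (forall y y', agree_twice (w y) (w y') -> y = y') ->
    (forall v, exists y, agree_twice (w y) v) ->
  exists2 A : 'M[option ('I_#|S| * 'I_#|S|)]_#|S|, is_mopls A & nb_filled A <= #|I|.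
Proof.
move=> pack cov.
have o1 : 1 < 4 by []. have o2 : 2 < 4 by []. have o3 : 3 < 4 by [].
pose x y p := enum_rank (w y p).
pose cell y := (x y ord0, x y (Ordinal o1)).
pose entry y := (x y (Ordinal o2), x y (Ordinal o3)).
pose A : 'M[option ('I_#|S| * 'I_#|S|)]_#|S| :=
  (\matrix_(i, j) omap entry [pick y | cell y == (i, j)])%R.
have xE y p : word (cell y) (entry y) p = x y p.
  by case: p => [[|[|[|[|p]]]] lp] //; rewrite /word /=; congr x; apply: val_inj.
have cell_inj : injective cell.
  move=> y y' [e0 e1]; apply: pack; exists ord0, (Ordinal o1).
  by split=> //; apply: enum_rank_inj.
have AE y : A (cell y).1 (cell y).2 = Some (entry y).
  rewrite mxE; case: pickP => [y'|/(_ y)]; last by rewrite -surjective_pairing eqxx.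
  by rewrite -surjective_pairing => /eqP/cell_inj ->.
have AP c e : A c.1 c.2 = Some e -> exists y, c = cell y /\ e = entry y.
  rewrite mxE; case: pickP => [y /eqP cE|] //= [<-].
  by exists y; rewrite cE -surjective_pairing.
exists A.
  apply/moplsP; split=> [|v].
    apply/oplsP => c c' e e' /AP[y [-> ->]] /AP[y' [-> ->]] [p [q [pq]]].
    rewrite !xE => ep eq; congr cell; apply: pack.
    by exists p, q; split=> //; apply: enum_rank_inj.
  have [y [p [q [pq ep eq]]]] := cov (fun p => enum_val (v p)).
  exists (cell y), (entry y); split=> //; exists p, q.
  by rewrite !xE /x ep eq !enum_valK.
apply: leq_trans (leq_imset_card cell predT); apply/subset_leq_card/subsetP => c.
rewrite inE; case Ac : (A c.1 c.2) => [e|] // _.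
by have [y [-> _]] := AP c e Ac; apply: imset_f.
Qed.

Lemma mopls_of_three_orthogonal_arrays (k1 k2 k3 : nat) :
    orthogonal_array k1 -> orthogonal_array k2 -> orthogonal_array k3 ->
  let n := k1 + k2 + k3 in
  exists2 A : 'M[option ('I_n * 'I_n)]_n, is_mopls A & nb_filled A <= k1 ^ 2 + k2 ^ 2 + k3 ^ 2.
Proof.
move=> [I1 [w1 [c1 cov1]]] [I2 [w2 [c2 cov2]]] [I3 [w3 [c3 cov3]]].
pose S : finType := ('I_k1 + 'I_k2 + 'I_k3)%type.
pose w (y : I1 + I2 + I3) p : S :=
  match y with
  | inl (inl y) => inl (inl (w1 y p))
  | inl (inr y) => inl (inr (w2 y p))
  | inr y => inr (w3 y p)
  end.
have cS : #|S| = k1 + k2 + k3 by rewrite !card_sum !card_ord.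
suff [A mA fA] : exists2 A : 'M[option ('I_#|S| * 'I_#|S|)]_#|S|, is_mopls A &
    nb_filled A <= #|{: I1 + I2 + I3}|.
  move: A mA fA; rewrite cS => A mA fA; exists A => //; apply: leq_trans fA _.
  by rewrite !card_sum !leq_add.
have pk k (I : finType) (v : I -> 'I_4 -> 'I_k) : #|I| <= k ^ 2 -> pair_cover v ->
    forall y y', agree_twice (v y) (v y') -> y = y'.
  by rewrite -{1}(card_ord k) => cI cov; apply: pair_cover_packing.
apply: (@mopls_of_code _ _ w).
  move=> [[y|y]|y] [[y'|y']|y'] [p [q []]] //= pq [ep] [eq].
  - by rewrite (pk _ _ _ c1 cov1 y y') //; exists p, q.
  - by rewrite (pk _ _ _ c2 cov2 y y') //; exists p, q.
  - by rewrite (pk _ _ _ c3 cov3 y y') //; exists p, q.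
move=> v; pose cl p : 'I_3 := match v p with
  | inl (inl _) => ord0 | inl (inr _) => inord 1 | inr _ => ord_max end.
(* Four positions, three parts. *)
have /injectivePn[p [q pq]] : ~~ injectiveb cl.
  by apply/negP => /injectiveP/leq_card; rewrite !card_ord.
rewrite /cl; case vp : (v p) => [[a|a]|a]; case vq : (v q) => [[b|b]|b] //;
  try by move/(congr1 val); rewrite /= inordK.
- by have [y [ya yb]] := cov1 p q a b pq; exists (inl (inl y)), p, q; rewrite vp vq /= ya yb.
- by have [y [ya yb]] := cov2 p q a b pq; exists (inl (inr y)), p, q; rewrite vp vq /= ya yb.
- by have [y [ya yb]] := cov3 p q a b pq; exists (inr y), p, q; rewrite vp vq /= ya yb.
Qed.

Theorem corollary2p2p1 (n : nat) (hn : 21 <= n) :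
  exists F : nat,
    [/\ is_min_filled_mopls n F,
        n = 0 %[mod 3] -> (F%:R = (n ^ 2)%:R / 3%:R :> rat)%R,
        n = 1 %[mod 3] \/ n = 2 %[mod 3] ->
          (F%:R = (n ^ 2 + 2)%:R / 3%:R :> rat)%R,
        (F%:Z = Num.ceil ((n ^ 2)%:R / 3%:R : rat))%R &
        forall A : 'M[option ('I_n * 'I_n)]_n,
          is_mopls A -> nb_filled A = F -> is_min_frequency A (n %/ 3)].
Proof.
have n0 : 0 < n by lia.
pose F := (n ^ 2 + 2) %/ 3; exists F.
have lower A : @is_mopls n A -> F <= nb_filled A.
  by case/(mopls_bound n0) => m [a [b [_ /sum_sq_bound le sq _]]]; apply: leq_trans sq.
have upper : exists2 A, @is_mopls n A & nb_filled A = F.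
  have [o1 o2 o3] : [/\ orthogonal_array (n %/ 3), orthogonal_array (n.+1 %/ 3) &
      orthogonal_array (n.+2 %/ 3)] by split; apply: oa_ge7; lia.
  move: (mopls_of_three_orthogonal_arrays o1 o2 o3) => /=.
  have -> : n %/ 3 + n.+1 %/ 3 + n.+2 %/ 3 = n by lia.
  move=> [A mA fA]; exists A => //; apply/eqP; rewrite eqn_leq lower // andbT.
  apply: leq_trans fA _; rewrite /F.
  have [k [r [nE r3]]] : exists k r, n = 3 * k + r /\ r < 3 by exists (n %/ 3), (n %% 3); lia.
  by case: r nE r3 => [|[|[|//]]] nE _; rewrite nE -!mulnn; nia.
have F3 : (3 * F = n ^ 2 /\ n %% 3 = 0) \/ (3 * F = n ^ 2 + 2 /\ n %% 3 != 0).
  have [k [r [nE r3]]] : exists k r, n = 3 * k + r /\ r < 3 by exists (n %/ 3), (n %% 3); lia.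
  by rewrite /F; case: r nE r3 => [|[|[|//]]] nE _; rewrite nE -!mulnn; [left | right | right]; nia.
have div3 N : 3 * F = N -> (F%:R = N%:R / 3%:R :> rat)%R.
  by move=> <-; rewrite natrM mulrC mulKf.
split.
- split=> // k [A mA <-]; exact: lower.
- move=> n3; apply: div3; rewrite mod0n in n3; lia.
- move=> n3; apply: div3; lia.
- apply/esym/Num.Theory.ceil_def.
  have E : ((n ^ 2)%:R = 3%:R * F%:R :> rat \/ (n ^ 2)%:R = 3%:R * F%:R - 2%:R :> rat)%R.
    rewrite -natrM; case: F3 => -[-> _]; [by left | right].
    by rewrite natrD addrK.
  rewrite intrB -pmulrn; case: E => ->; apply/andP; split; lra.
move=> A mA fA; have [m [a [b [mmin sum sq nm]]]] := mopls_bound n0 mA.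
by rewrite fA in sq nm; rewrite -(@min_freq_of_sum_sq n m a b) //; lia.
Qed.
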